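(* Let $K$ be any field, let $V$ be a $K$-vector space of dimension $m+n$, let $X=\mathrm{SL}(V)/P=\mathbb{G}(m,m+n)$ be the grassmannian of $m$-planes in $V$, and let $\mathcal{O}_X(d)$ be the $d$'th power of the line bundle coming from the Plücker embedding. Then the Taylor morphism $$T^l:\mathrm{H}^0(X,\mathcal{O}_X(d))\otimes\mathcal{O}_X\to\mathcal{P}^l_X(\mathcal{O}_X(d))$$ is surjective when $1\leq l\leq d$.
   Context: $P\subseteq\mathrm{SL}(V)$ is the subgroup fixing (stabilizing) an $m$-dimensional subspace $W\subseteq V$. $i:X\to\mathbb{P}(\wedge^mV^* )$ is the Plücker embedding into the projective space of lines in $\wedge^mV$, and $\mathcal{O}_X(d)=i^*\mathcal{O}(1)^{\otimes d}$. With $Y=X\times_KX$, projections $p,q:Y\to X$ and $\mathcal{I}_\Delta\subseteq\mathcal{O}_Y$ the ideal of the diagonal, the $l$'th jet bundle is $\mathcal{P}^l_X(\mathcal{O}_X(d))=p_*\big((\mathcal{O}_Y/\mathcal{I}_\Delta^{l+1})\otimes q^*\mathcal{O}_X(d)\big)$, regarded as an $\mathcal{O}_X$-module via the left structure. The Taylor morphism $T^l$ is obtained by applying $p_*(-\otimes q^*\mathcal{O}_X(d))$ to $\mathcal{O}_Y\to\mathcal{O}_Y/\mathcal{I}_\Delta^{l+1}$ and using $p_*q^*\mathcal{O}_X(d)\cong\mathrm{H}^0(X,\mathcal{O}_X(d))\otimes\mathcal{O}_X$. *)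

(* Defs.v *)
From HB Require Import structures.
From mathcomp Require Import all_boot all_order all_algebra.
From mathcomp Require Import generic_quotient fraction mpoly.

Set Implicit Arguments.
Unset Strict Implicit.
Unset Printing Implicit Defensive.

Import GRing.Theory.
Local Open Scope ring_scope.

(* Schemes are not available, so the integral K-schemes X = G(m, V) and
   Y = X x_K X are described as follows.

   - A point of X is a field extension F of K together with an m-dimensional
     F-subspace of F (x) V; a point of Y is such an extension F with two such
     subspaces.  Every point of the scheme is represented (by any of its values
     in an extension of its residue field); points of this type that represent
     the same scheme point lie in the same Zariski open sets and have the same
     local rings, so the sheaves are those of the scheme.

   - As X and Y are integral, an invertible sheaf is given by its stalks inside
     one fixed field, and its sections over an open set are the elements of that
     field lying in all the stalks over this open set.  The fixed field is
     K(A), resp. K(A, B), where A and B are generic m x dim V matrices whose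
     rows frame the subspaces; in it sections of O(d) are quotients of
     homogeneous polynomials in the Pluecker coordinates.  *)

(* Additive span of the products a * b with a in A, b in B. *)
Definition span_prod (L : pzRingType) (A B : L -> Prop) (u : L) : Prop :=
  exists r (a b : 'I_r -> L),
    [/\ forall i, A (a i), forall i, B (b i) & u = \sum_i a i * b i].

Definition map_frac (R S : idomainType) (h : R -> S) (u : {fraction R}) :
    {fraction S} :=
  tofrac (h (\n_(repr u))) / tofrac (h (\d_(repr u))).

Section Grassmannian.

Variables (K : fieldType) (V : vectType K) (m : nat).

(* F (x) V is 'rV[F]_(dim V), in the coordinates v2r : V -> 'rV[K]_(dim V). *)
Record plane (F : fieldType) := Plane {
  plane_space :> {vspace 'rV[F]_(dim V)};
  plane_dim : \dim plane_space = m }.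

Definition frame (F : fieldType) (W : plane F) : 'M[F]_(m, dim V) :=
  \matrix_(i < m) (vbasis W)`_i.

Record Xpoint := XPoint {
  Xfield : fieldType;
  Xstruct : {rmorphism K -> Xfield};
  Xplane : plane Xfield }.

Record Ypoint := YPoint {
  Yfield : fieldType;
  Ystruct : {rmorphism K -> Yfield};
  Yplane1 : plane Yfield;
  Yplane2 : plane Yfield }.

Definition pr_p (P : Ypoint) : Xpoint := XPoint (Ystruct P) (Yplane1 P).
Definition pr_q (P : Ypoint) : Xpoint := XPoint (Ystruct P) (Yplane2 P).

Definition on_diagonal (P : Ypoint) : Prop :=
  plane_space (Yplane1 P) = plane_space (Yplane2 P).

Local Notation N := (m * dim V)%N.
Local Notation RX := {mpoly K[N]}.
Local Notation RY := {mpoly K[N + N]}.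
Local Notation LX := {fraction RX}.
Local Notation LY := {fraction RY}.

Definition evalX (x : Xpoint) (f : RX) : Xfield x :=
  mmap (Xstruct x) (fun k => mxvec (frame (Xplane x)) 0 k) f.

Definition evalY (P : Ypoint) (f : RY) : Yfield P :=
  mmap (Ystruct P)
    (fun k => row_mx (mxvec (frame (Yplane1 P))) (mxvec (frame (Yplane2 P))) 0 k)
    f.

Definition pull_p (f : RX) : RY := f \mPo [tuple 'X_(lshift N i) | i < N].
Definition pull_q (f : RX) : RY := f \mPo [tuple 'X_(rshift N i) | i < N].

(* f(A, B) |-> f(A, A) *)
Definition restr_diagonal (f : RY) : RX :=
  f \mPo [tuple 'X_(match split i with inl j => j | inr j => j end)
         | i < N + N].

(* The basis of wedge^m V is indexed by the m-subsets of the basis of V. *)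
Definition plidx := {J : {set 'I_(dim V)} | #|J| == m}.

Definition plucker (R : comNzRingType) (A : 'M[R]_(m, dim V)) (J : plidx) : R :=
  \det (colsub (fun j : 'I_m =>
                  enum_val (cast_ord (esym (eqP (valP J))) j)) A).

Definition generic_frame : 'M[RX]_(m, dim V) := vec_mx (\row_k 'X_k).

(* Homogeneous polynomials of degree k on P(wedge^m V^* ), restricted to X. *)
Definition formX (k : nat) (f : RX) : Prop :=
  exists2 Phi : {mpoly K[#|{: plidx}|]}, Phi \is k.-homog
    & f = Phi \mPo [tuple plucker generic_frame (enum_val i)
                   | i < #|{: plidx}|].

(* Bihomogeneous forms of bidegree (a, b), restricted to Y. *)
Definition formY (a b : nat) (f : RY) : Prop :=
  exists r (g h : 'I_r -> RX),
    [/\ forall i, formX a (g i), forall i, formX b (h i)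
      & f = \sum_i pull_p (g i) * pull_q (h i)].

Definition openX (U : Xpoint -> Prop) : Prop :=
  forall x, U x -> exists k f,
    [/\ formX k f, evalX x f != 0 & forall y, evalX y f != 0 -> U y].

Definition openY (U : Ypoint -> Prop) : Prop :=
  forall P, U P -> exists a b f,
    [/\ formY a b f, evalY P f != 0 & forall Q, evalY Q f != 0 -> U Q].

(* O_X(d)_x, the restriction of O(1)^{(x) d}; O_X is the case d = 0. *)
Definition stalkX (d : nat) (x : Xpoint) (u : LX) : Prop :=
  exists k f g,
    [/\ formX (k + d) f, formX k g, evalX x g != 0 & u = tofrac f / tofrac g].

(* Gamma(U, O_X(d)) *)
Definition sectionX (d : nat) (U : Xpoint -> Prop) (u : LX) : Prop :=
  forall x, U x -> stalkX d x u.

(* O_{Y,P} *)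
Definition stalkY (P : Ypoint) (u : LY) : Prop :=
  exists a b f g,
    [/\ formY a b f, formY a b g, evalY P g != 0 & u = tofrac f / tofrac g].

(* (I_Delta)_P, the kernel of O_{Y,P} -> (Delta_* O_X)_P; the target is 0 when
   P is not on the diagonal. *)
Definition ideal_diagonal (P : Ypoint) (u : LY) : Prop :=
  exists a b f g,
    [/\ formY a b f, formY a b g, evalY P g != 0,
        on_diagonal P -> restr_diagonal f = 0 & u = tofrac f / tofrac g].

(* (q^* O_X(d))_P *)
Definition pullback_q (d : nat) (P : Ypoint) : LY -> Prop :=
  span_prod (stalkY P)
    (fun v => exists2 u, stalkX d (pr_q P) u & v = map_frac pull_q u).

(* (I_Delta^{l+1} q^* O_X(d))_P *)
Definition ideal_pullback_q (d l : nat) (P : Ypoint) : LY -> Prop :=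
  iter l.+1 (span_prod (ideal_diagonal P)) (pullback_q d P).

(* Sections over U of P^l_X(O_X(d)), that is, sections over p^-1(U) of
     (O_Y / I_Delta^{l+1}) (x) q^* O_X(d) = q^* O_X(d) / I_Delta^{l+1} q^* O_X(d).
   This quotient sheaf is the sheaf associated with the presheaf quotient: a
   section is a family of elements of its stalks which is locally induced by
   sections of q^* O_X(d).  The family is given by representatives s P, to be
   compared with [jet_eq]. *)
Definition jet_section (d l : nat) (U : Xpoint -> Prop) (s : Ypoint -> LY) :
    Prop :=
  forall P, U (pr_p P) -> exists (O : Ypoint -> Prop) (u : LY),
    [/\ openY O, O P, forall Q, O Q -> U (pr_p Q)
      & forall Q, O Q ->
          pullback_q d Q u /\ ideal_pullback_q d l Q (s Q - u)].

Definition jet_eq (d l : nat) (U : Xpoint -> Prop) (s t : Ypoint -> LY) : Prop :=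
  forall P, U (pr_p P) -> ideal_pullback_q d l P (s P - t P).

(* The section over U of H^0(X, O_X(d)) (x)_K O_X given by
   \sum_i sigma i (x) phi i, with phi i in O_X(U), is mapped to the class of
   \sum_i p^*(phi i) q^*(sigma i). *)
Definition taylor r (sigma phi : 'I_r -> LX) : Ypoint -> LY :=
  fun _ => \sum_i map_frac pull_p (phi i) * map_frac pull_q (sigma i).

(* Surjectivity as a morphism of sheaves: every section of the target is
   locally in the image. *)
Definition taylor_surjective (d l : nat) : Prop :=
  forall (U : Xpoint -> Prop) (s : Ypoint -> LY),
    openX U -> jet_section d l U s ->
  forall x, U x -> exists W : Xpoint -> Prop,
    [/\ openX W, W x, forall y, W y -> U y
      & exists r (sigma phi : 'I_r -> LX),
          [/\ forall i, sectionX d (fun=> True) (sigma i),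
              forall i, sectionX 0 W (phi i)
            & jet_eq d l W (taylor sigma phi) s]].

End Grassmannian.

(* Main.v *)
From HB Require Import structures.
Require Import Defs.
From mathcomp Require Import all_boot all_order all_algebra.
From mathcomp Require Import generic_quotient fraction mpoly.

(* The argument uses only that X is integral in a projective space.  Near the
   diagonal point over x choose a Pluecker coordinate pi with pi(x) != 0, so that
   a section of q^* O(d) is v * q^*(pi)^d with v = F / G regular, and let A be
   the ring p^* O_X(W) on a small neighbourhood W of x.  Modulo I_Delta, the
   function q^* t is congruent to p^* t for every ratio t of forms of equal
   degree.  Hence, modulo I_Delta^{l+1}, every polynomial in the q^* t_i, where
   t_i are the ratios of the Pluecker coordinates to pi, is congruent to one of
   degree at most l with coefficients in A, and the denominator of v can be
   inverted as a geometric series around p^* (G|Delta).  As l <= d, multiplying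
   the polynomial of degree at most l by q^*(pi)^d gives an A-combination of
   forms of degree d, which are global sections.  Off the diagonal I_Delta is
   the unit ideal and there is nothing to prove. *)

Set Implicit Arguments.
Unset Strict Implicit.
Unset Printing Implicit Defensive.

Import GRing.Theory.
Local Open Scope ring_scope.

(** * Morphisms of polynomial rings and of their fraction fields *)

Lemma mpoly_rmorph_ext (R : comNzRingType) (n : nat) (S : comNzRingType)
    (f g : {rmorphism {mpoly R[n]} -> S}) :
  (forall c, f c%:MP = g c%:MP) -> (forall i, f 'X_i = g 'X_i) -> f =1 g.
Proof.
move=> eqC eqX p; rewrite [p]mpolyE !rmorph_sum; apply: eq_bigr => m _.
rewrite -mul_mpolyC !rmorphM eqC mpolyXE_id !rmorph_prod; congr (_ * _).
by apply: eq_bigr => i _; rewrite !rmorphXn eqX.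
Qed.

Section MapFrac.
Variables (R S : idomainType) (h : {rmorphism R -> S}).

Lemma frac_repr (u : {fraction R}) :
  u = tofrac \n_(repr u) / tofrac \d_(repr u).
Proof.
have dn0 : \d_(repr u) != 0 by exact: denom_ratioP.
apply: (mulIf (x := tofrac \d_(repr u))); first by rewrite tofrac_eq0.
rewrite mulfVK ?tofrac_eq0 // -{1}[u]reprK; unlock FracField.tofrac.
rewrite -[LHS]FracField.pi_mul; apply/eqmodP; rewrite /= FracField.equivfE.
rewrite /FracField.mulf !numden_Ratio ?oner_neq0 ?mulf_neq0 ?oner_neq0 //.
by rewrite !mulr1 mulrC.
Qed.

Hypothesis h_inj : injective h.

(** Any two representatives of a fraction cross-multiply to the same product, and injectivity of [h]
    keeps denominators nonzero; hence the choice made by [repr] does not matter. *)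
Lemma map_frac_div (a b : R) : b != 0 ->
  map_frac h (tofrac a / tofrac b) = tofrac (h a) / tofrac (h b).
Proof.
move=> b0; rewrite /map_frac; set u := tofrac a / tofrac b.
have d0 : \d_(repr u) != 0 by exact: denom_ratioP.
have hn0 x : x != 0 -> tofrac (h x) != 0.
  by move=> x0; rewrite tofrac_eq0 -(rmorph0 h) (inj_eq h_inj).
have e : \n_(repr u) * b = a * \d_(repr u).
  apply/eqP; rewrite -tofrac_eq !tofracM -eqr_div ?tofrac_eq0 //.
  by rewrite -frac_repr.
apply/eqP; rewrite eqr_div ?hn0 // -!tofracM -!rmorphM.
by rewrite e.
Qed.

End MapFrac.

(** * Forms on X and Y: pullbacks, evaluation, restriction to the diagonal *)

Section Forms.
Variables (K : fieldType) (V : vectType K) (m : nat).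

Local Notation N := (m * dim V)%N.
Local Notation RX := {mpoly K[N]}.
Local Notation RY := {mpoly K[N + N]}.
Local Notation LX := {fraction RX}.
Local Notation LY := {fraction RY}.
Local Notation Xpoint := (Xpoint V m).
Local Notation Ypoint := (Ypoint V m).
Local Notation plidx := (plidx V m).

HB.instance Definition _ := GRing.RMorphism.copy (@pull_p K V m)
  (comp_mpoly [tuple 'X_(lshift N i) | i < N]).
HB.instance Definition _ := GRing.RMorphism.copy (@pull_q K V m)
  (comp_mpoly [tuple 'X_(rshift N i) | i < N]).
HB.instance Definition _ := GRing.RMorphism.copy (@restr_diagonal K V m)
  (comp_mpoly [tuple 'X_(match split i with inl j => j | inr j => j end)
         | i < N + N]).
HB.instance Definition _ (x : Xpoint) := GRing.RMorphism.copy (evalX x)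
  (mmap (Xstruct x) (fun k => mxvec (frame (Xplane x)) 0 k)).
HB.instance Definition _ (P : Ypoint) := GRing.RMorphism.copy (evalY P)
  (mmap (Ystruct P)
    (fun k => row_mx (mxvec (frame (Yplane1 P))) (mxvec (frame (Yplane2 P))) 0 k)).

Local Notation pX := (@pull_p K V m).
Local Notation qX := (@pull_q K V m).
Local Notation restr := (@restr_diagonal K V m).

Lemma comp_mpolyXt n k (t : 'I_n -> {mpoly K[k]}) i :
  'X_i \mPo [tuple t j | j < n] = t i.
Proof. by rewrite comp_mpolyXU -tnth_nth tnth_mktuple. Qed.

Lemma restr_pull_p : cancel pX restr.
Proof.
apply: (@mpoly_rmorph_ext _ _ _ (restr \o pX) idfun) => [c|i] /=.
  by rewrite /pull_p /restr_diagonal !comp_mpolyC.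
rewrite /pull_p /restr_diagonal !comp_mpolyXt.
by rewrite (unsplitK (inl i)).
Qed.

Lemma restr_pull_q : cancel qX restr.
Proof.
apply: (@mpoly_rmorph_ext _ _ _ (restr \o qX) idfun) => [c|i] /=.
  by rewrite /pull_q /restr_diagonal !comp_mpolyC.
rewrite /pull_q /restr_diagonal !comp_mpolyXt.
by rewrite (unsplitK (inr i)).
Qed.

Lemma evalY_pull_p P f : evalY P (pX f) = evalX (pr_p P) f.
Proof.
move: f; apply: (@mpoly_rmorph_ext _ _ _ (evalY P \o pX) (evalX (pr_p P))) => [c|i] /=.
  by rewrite /pull_p comp_mpolyC /evalY /evalX !mmapC.
by rewrite /pull_p comp_mpolyXt /evalY /evalX !mmapX !mmap1U row_mxEl.
Qed.

Lemma evalY_pull_q P f : evalY P (qX f) = evalX (pr_q P) f.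
Proof.
move: f; apply: (@mpoly_rmorph_ext _ _ _ (evalY P \o qX) (evalX (pr_q P))) => [c|i] /=.
  by rewrite /pull_q comp_mpolyC /evalY /evalX !mmapC.
by rewrite /pull_q comp_mpolyXt /evalY /evalX !mmapX !mmap1U row_mxEr.
Qed.

(** The frame depends only on the subspace, so at a diagonal point both blocks of variables take the
    same values. *)
Lemma evalX_restr P f : on_diagonal P -> evalX (pr_p P) (restr f) = evalY P f.
Proof.
move=> diagP.
have eqf : frame (Yplane1 P) = frame (Yplane2 P) by rewrite /frame diagP.
move: f; apply: (@mpoly_rmorph_ext _ _ _ (evalX (pr_p P) \o restr) (evalY P))
  => [c|i] /=.
  by rewrite /restr_diagonal comp_mpolyC /evalY /evalX !mmapC.
rewrite /restr_diagonal comp_mpolyXt /evalY /evalX !mmapX !mmap1U -eqf /=.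
by rewrite mxE; case: splitP.
Qed.

Lemma evalX_X (x : Xpoint) k : evalX x 'X_k = mxvec (frame (Xplane x)) 0 k.
Proof. by rewrite [LHS]mmapX mmap1U. Qed.

Lemma evalXM (x : Xpoint) : {morph evalX x : f g / f * g}.
Proof. exact: rmorphM. Qed.

Lemma evalYM (P : Ypoint) : {morph evalY P : f g / f * g}.
Proof. exact: rmorphM. Qed.

Lemma restrM : {morph restr : f g / f * g}.
Proof. exact: rmorphM. Qed.

Lemma restrB : {morph restr : f g / f - g}.
Proof. exact: rmorphB. Qed.

Lemma pull_pC c : pX c%:MP = c%:MP.
Proof. exact: comp_mpolyC. Qed.

Lemma pull_qC c : qX c%:MP = c%:MP.
Proof. exact: comp_mpolyC. Qed.

Definition plucker_form (i : 'I_#|{: plidx}|) : RX :=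
  plucker (generic_frame V m) (enum_val i).
Local Notation pl := plucker_form.

Lemma formX0 k : formX k (0 : RX).
Proof. by exists 0; rewrite ?dhomog0 ?comp_mpoly0. Qed.

Lemma formXD k (f g : RX) : formX k f -> formX k g -> formX k (f + g).
Proof.
move=> [F homF ->] [G homG ->]; exists (F + G); first exact: dhomogD.
by rewrite rmorphD.
Qed.

Lemma formXM j k (f g : RX) : formX j f -> formX k g -> formX (j + k) (f * g).
Proof.
move=> [F homF ->] [G homG ->]; exists (F * G); first exact: dhomogM.
by rewrite rmorphM.
Qed.

Lemma formXC c : formX 0 (c%:MP : RX).
Proof.
exists c%:MP; last by rewrite comp_mpolyC.
by rewrite -[c]mulr1 mpolyCM mpolyC1 mul_mpolyC dhomogZ ?dhomog1.
Qed.

Lemma formX_pl i : formX 1 (pl i).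
Proof.
by exists 'X_i; rewrite ?comp_mpolyXU -?tnth_nth ?tnth_mktuple // dhomogX /= mdeg1.
Qed.

Lemma formX_exp j k (f : RX) : formX j f -> formX (j * k) (f ^+ k).
Proof.
move=> ff; elim: k => [|k IHk]; first by rewrite muln0 expr0 -mpolyC1; exact: formXC.
by rewrite mulnS exprS; exact: formXM.
Qed.

(** A homogeneous polynomial of degree 0 is its constant coefficient, which substitution leaves
    unchanged. *)
Lemma formX_degree0 (f : RX) : formX 0 f -> exists c, f = c%:MP.
Proof.
case=> F homF ->; exists F@_0%MM; set t := mktuple _.
rewrite -(comp_mpolyC _ t); congr (_ \mPo _); apply/mpolyP => n; rewrite mcoeffC eq_sym.
have [->|n0] := eqVneq n 0%MM; first by rewrite mulr1.
by rewrite mulr0 (dhomog_nemf_coeff homF) // mdeg_eq0.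
Qed.

(** Induction principle: each monomial of degree [k.+1] in the Pluecker coordinates is one
    coordinate times a monomial of degree [k]. *)
Lemma formX_degreeS k (C : RX -> Prop) :
    C 0 -> (forall f g, C f -> C g -> C (f + g)) ->
    (forall i f, formX k f -> C (pl i * f)) ->
  forall f, formX k.+1 f -> C f.
Proof.
move=> C0 CD Cpl f [F homF ->]; rewrite comp_mpolyEX big_seq.
apply: (big_ind C) => // n nF.
have degn : mdeg n = k.+1 by exact: (dhomogP _ _ _ homF).
(* The degree is positive, so some variable divides the monomial. *)
have [i ni] : exists i, n i != 0%N.
  apply/existsP; rewrite -negb_forall; apply/negP => /forallP n0.
  have := congr1 mdeg (_ : n = 0%MM); rewrite degn mdeg0 => H.
  by suff: k.+1 = 0%N by []; apply: H; apply/mnmP => i; rewrite mnm0E; apply/eqP.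
have Un : (U_(i) <= n)%MM by rewrite lep1mP.
rewrite -{2}(submK Un) addmC mpolyXD rmorphM /= scalerAr comp_mpolyXU -tnth_nth.
rewrite tnth_mktuple; apply: Cpl.
exists (F@_n *: 'X_[n - U_(i)]); last by rewrite comp_mpolyZ.
rewrite dhomogZ // dhomogX; apply/eqP.
by have := congr1 mdeg (submK Un); rewrite mdegD mdeg1 addn1 degn => -[].
Qed.

Lemma formY_gen a b (g h : RX) : formX a g -> formX b h -> formY a b (pX g * qX h).
Proof.
move=> ag bh; exists 1%N, (fun=> g), (fun=> h).
by split=> //; rewrite big_ord1.
Qed.

Lemma formY0 a b : formY a b (0 : RY).
Proof.
by exists 0%N, (fun=> 0), (fun=> 0); split=> [[]|[]|] //; rewrite big_ord0.
Qed.

Lemma formYD a b (f g : RY) : formY a b f -> formY a b g -> formY a b (f + g).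
Proof.
move=> [r [g1 [h1 [fg1 fh1 ->]]]] [s [g2 [h2 [fg2 fh2 ->]]]].
exists (r + s)%N, (fun i => match split i with inl j => g1 j | inr j => g2 j end).
exists (fun i => match split i with inl j => h1 j | inr j => h2 j end).
split=> [i|i|]; try by case: split.
by rewrite big_split_ord /=; congr (_ + _); apply: eq_bigr => i _;
  [rewrite (unsplitK (inl i)) | rewrite (unsplitK (inr i))].
Qed.

Lemma formYM a b a' b' (f g : RY) :
  formY a b f -> formY a' b' g -> formY (a + a') (b + b') (f * g).
Proof.
move=> [r [g1 [h1 [fg1 fh1 ->]]]] [s [g2 [h2 [fg2 fh2 ->]]]].
rewrite big_distrlr /=.
apply: (big_ind (formY (a + a') (b + b'))) => [|u v|i _];
  [exact: formY0|exact: formYD|].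
apply: (big_ind (formY (a + a') (b + b'))) => [|u v|j _];
  [exact: formY0|exact: formYD|].
by rewrite mulrACA -!rmorphM; apply: formY_gen; exact: formXM.
Qed.

Lemma formY_pull_p a (f : RX) : formX a f -> formY a 0 (pX f).
Proof.
move=> af; rewrite -[pX f]mulr1 -(rmorph1 qX); apply: formY_gen => //.
by rewrite -mpolyC1; exact: formXC.
Qed.

Lemma formY_pull_q b (f : RX) : formX b f -> formY 0 b (qX f).
Proof.
move=> bf; rewrite -[qX f]mul1r -(rmorph1 pX); apply: formY_gen => //.
by rewrite -mpolyC1; exact: formXC.
Qed.

Lemma formX_restr a b (f : RY) : formY a b f -> formX (a + b) (restr f).
Proof.
move=> [r [g [h [fg fh ->]]]]; rewrite rmorph_sum.
apply: (big_ind (formX (a + b))) => [|? ?|i _]; [exact: formX0|exact: formXD|].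
by rewrite rmorphM /= restr_pull_p restr_pull_q; exact: formXM.
Qed.

End Forms.

Opaque pull_p pull_q restr_diagonal evalX evalY.

(** * Additive spans of products *)

Section SpanProd.
Variables (L : comNzRingType) (A B : L -> Prop).

Lemma span_prod_gen a b : A a -> B b -> span_prod A B (a * b).
Proof.
by move=> Aa Bb; exists 1%N, (fun=> a), (fun=> b); split=> //; rewrite big_ord1.
Qed.

Lemma span_prod0 : span_prod A B 0.
Proof.
by exists 0%N, (fun=> 0), (fun=> 0); split=> [[]|[]|] //; rewrite big_ord0.
Qed.

Lemma span_prodD u v : span_prod A B u -> span_prod A B v -> span_prod A B (u + v).
Proof.
move=> [r [a1 [b1 [Aa1 Bb1 ->]]]] [s [a2 [b2 [Aa2 Bb2 ->]]]].
exists (r + s)%N, (fun i => match split i with inl j => a1 j | inr j => a2 j end).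
exists (fun i => match split i with inl j => b1 j | inr j => b2 j end).
split=> [i|i|]; try by case: split.
by rewrite big_split_ord /=; congr (_ + _); apply: eq_bigr => i _;
  [rewrite (unsplitK (inl i)) | rewrite (unsplitK (inr i))].
Qed.

Lemma span_prod_ind (C : L -> Prop) :
    C 0 -> (forall u v, C u -> C v -> C (u + v)) ->
    (forall a b, A a -> B b -> C (a * b)) ->
  forall u, span_prod A B u -> C u.
Proof.
move=> C0 CD CM u [r [a [b [Aa Bb ->]]]].
by apply: (big_ind C) => // i _; apply: CM.
Qed.

Lemma span_prodMl c u :
  (forall a, A a -> A (c * a)) -> span_prod A B u -> span_prod A B (c * u).
Proof.
move=> AM; elim/span_prod_ind => [|v w|a b Aa Bb].
- by rewrite mulr0; exact: span_prod0.
- by rewrite mulrDr; exact: span_prodD.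
- by rewrite mulrA; apply: span_prod_gen => //; exact: AM.
Qed.

End SpanProd.

(** * Stalks on Y and the powers of the ideal of the diagonal *)

Section Stalks.
Variables (K : fieldType) (V : vectType K) (m : nat).

Local Notation N := (m * dim V)%N.
Local Notation RX := {mpoly K[N]}.
Local Notation RY := {mpoly K[N + N]}.
Local Notation LX := {fraction RX}.
Local Notation LY := {fraction RY}.
Local Notation Xpoint := (Xpoint V m).
Local Notation Ypoint := (Ypoint V m).
Local Notation pX := (@pull_p K V m).
Local Notation qX := (@pull_q K V m).
Local Notation restr := (@restr_diagonal K V m).
Local Notation "f %:F" := (tofrac f).

Let pI : injective pX := can_inj (@restr_pull_p K V m).

Lemma evalX_neq0 (x : Xpoint) (f : RX) : evalX x f != 0 -> f != 0.
Proof. by apply: contraNneq => ->; rewrite rmorph0. Qed.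

Lemma formX1 : formX 0 (1 : RX).
Proof. by rewrite -mpolyC1; exact: formXC. Qed.

Lemma stalkYM (P : Ypoint) (u v : LY) : stalkY P u -> stalkY P v -> stalkY P (u * v).
Proof.
move=> [a [b [f [g [ff fg g0 ->]]]]] [a' [b' [f' [g' [ff' fg' g0' ->]]]]].
exists (a + a')%N, (b + b')%N, (f * f'), (g * g').
split; [exact: formYM|exact: formYM|by rewrite rmorphM mulf_neq0|].
by rewrite mulf_div -!tofracM.
Qed.

Lemma ideal_diagonalM (P : Ypoint) (u v : LY) :
  stalkY P u -> ideal_diagonal P v -> ideal_diagonal P (u * v).
Proof.
move=> [a [b [f [g [ff fg g0 ->]]]]] [a' [b' [f' [g' [ff' fg' g0' rf' ->]]]]].
exists (a + a')%N, (b + b')%N, (f * f'), (g * g').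
split; [exact: formYM|exact: formYM|by rewrite rmorphM mulf_neq0| |].
  by move=> diagP; rewrite rmorphM /= rf' // mulr0.
by rewrite mulf_div -!tofracM.
Qed.

Lemma ideal_diagonal_stalkY (P : Ypoint) (u : LY) : ideal_diagonal P u -> stalkY P u.
Proof. by move=> [a [b [f [g [ff fg g0 _ ->]]]]]; exists a, b, f, g. Qed.

Lemma stalkY_form00 (P : Ypoint) (f : RY) : formY 0 0 f -> stalkY P f%:F.
Proof.
move=> ff; exists 0%N, 0%N, f, 1; split=> //; rewrite ?rmorph1 ?oner_eq0 ?divr1 //.
by rewrite -(rmorph1 pX); apply: formY_pull_p; exact: formX1.
Qed.

Lemma stalkY1 (P : Ypoint) : stalkY P 1.
Proof.
rewrite -tofrac1; apply: stalkY_form00; rewrite -(rmorph1 pX).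
by apply: formY_pull_p; exact: formX1.
Qed.

Lemma stalkYN1 (P : Ypoint) : stalkY P (-1).
Proof.
rewrite -tofrac1 -tofracN; apply: stalkY_form00.
rewrite -(rmorph1 pX) -rmorphN -mpolyC1 -mpolyCN.
by apply: formY_pull_p; exact: formXC.
Qed.

Lemma stalkY_pull_p (P : Ypoint) u :
  stalkX 0 (pr_p P) u -> stalkY P (map_frac pX u).
Proof.
move=> [k [f [g [ff fg g0 ->]]]]; rewrite addn0 in ff.
exists k, 0%N, (pX f), (pX g); split; try exact: formY_pull_p.
  by rewrite evalY_pull_p.
by rewrite map_frac_div ?(evalX_neq0 g0).
Qed.

Section Powers.
Variables (d : nat) (P : Ypoint).

(** The exponent is free here to allow induction from [k = 0], the stalk of the pullback itself;
    [ideal_pullback_q d l P] is the case [k = l.+1]. *)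
Definition ideal_power_pullback_q k : LY -> Prop :=
  iter k (span_prod (ideal_diagonal P)) (pullback_q d P).
Local Notation M := ideal_power_pullback_q.

Lemma ideal_power0 k : M k 0.
Proof. by case: k => [|k]; exact: span_prod0. Qed.

Lemma ideal_powerD k u v : M k u -> M k v -> M k (u + v).
Proof. by case: k => [|k]; exact: span_prodD. Qed.

Lemma ideal_powerMl k u v : stalkY P u -> M k v -> M k (u * v).
Proof.
case: k => [|k] Pu; apply: span_prodMl => a; first exact: stalkYM.
exact: ideal_diagonalM.
Qed.

Lemma ideal_powerB k u v : M k u -> M k v -> M k (u - v).
Proof.
by move=> Mu Mv; apply: ideal_powerD => //; rewrite -mulN1r;
  apply: ideal_powerMl => //; exact: stalkYN1.
Qed.

Lemma ideal_powerS k u : M k.+1 u -> M k u.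
Proof.
elim/span_prod_ind => [|? ?|a b]; [exact: ideal_power0|exact: ideal_powerD|].
by move=> /ideal_diagonal_stalkY; exact: ideal_powerMl.
Qed.

Lemma ideal_power_pullback k u : M k u -> pullback_q d P u.
Proof. by elim: k => // k IHk /ideal_powerS. Qed.

(** Off the diagonal the vanishing condition in [ideal_diagonal] is vacuous, so the ideal contains
    1. *)
Lemma ideal_power_off_diagonal k u :
  ~ on_diagonal P -> pullback_q d P u -> M k u.
Proof.
move=> offP Mu; elim: k => // k IHk; rewrite -[u]mul1r; apply: span_prod_gen => //.
have [a [b [f [g [ff fg g0 ->]]]]] := stalkY1 P.
by exists a, b, f, g; split=> // /offP.
Qed.

End Powers.

Lemma sectionX_form d (f : RX) : formX d f -> sectionX d (fun=> True) f%:F.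
Proof.
move=> ff x _; exists 0%N, f, 1; rewrite rmorph1 oner_eq0 divr1.
by split=> //; exact: formX1.
Qed.

(** This serves at points off the diagonal, where membership in the pullback already gives
    membership in every power. *)
Lemma taylor_pullback_q d (P : Ypoint) (U : Xpoint -> Prop) r (sigma phi : 'I_r -> LX) :
    (forall i, sectionX d (fun=> True) (sigma i)) ->
    (forall i, sectionX 0 U (phi i)) -> U (pr_p P) ->
  pullback_q d P (taylor sigma phi P).
Proof.
move=> hs hp UP; apply: (big_ind (pullback_q d P)).
- exact: span_prod0.
- by move=> ? ?; exact: span_prodD.
move=> i _; apply: span_prod_gen; first exact/stalkY_pull_p/hp.
by exists (sigma i) => //; exact: hs.
Qed.

End Stalks.

(** * Approximation modulo powers of an ideal, in an abstract ring *)

(* Below, A is p^* O_X(W), S is the intersection of the local rings of Y at the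
   diagonal points over W, I that of the ideals of the diagonal, B e consists of
   the q^*(f / pi^e) with f a form of degree e, and R k is I_Delta^k. *)
Section Approximation.
Variables (L : comNzRingType) (A S I : L -> Prop) (B R : nat -> L -> Prop).
Local Notation T e := (span_prod A (B e)).

Hypotheses (A1 : A 1) (AN1 : A (-1)) (AM : forall a b, A a -> A b -> A (a * b)).
Hypotheses (B00 : forall b, B 0 b -> A b) (B01 : B 0 1) (B11 : B 1 1).
Hypothesis BM : forall e e' b b', B e b -> B e' b' -> B (e + e') (b * b').
Hypothesis BS : forall e b, B e.+1 b -> span_prod (B 1) (B e) b.
Hypothesis Bdelta : forall b, B 1 b -> exists2 t, A t & I (b - t).
Hypotheses (AS : forall a, A a -> S a) (IS : forall a, I a -> S a).
Hypotheses (R0 : forall k, R k 0) (S_R0 : forall v, S v -> R 0 v).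
Hypothesis RD : forall k u v, R k u -> R k v -> R k (u + v).
Hypothesis RS : forall k u v, S u -> R k v -> R k (u * v).
Hypothesis RI : forall k u v, I u -> R k v -> R k.+1 (u * v).

(* For k = 0 the only combination of degree < k is 0. *)
Definition approximable k (v : L) : Prop := exists2 w,
  (if k is e.+1 then T e w else w = 0) & R k (v - w).

Lemma TM e e' u v : T e u -> T e' v -> T (e + e') (u * v).
Proof.
move=> Tu Tv; elim/span_prod_ind: Tu => [|? ?|a b Aa Bb].
- by rewrite mul0r; exact: span_prod0.
- by rewrite mulrDl; exact: span_prodD.
elim/span_prod_ind: Tv => [|? ?|a' b' Aa' Bb'].
- by rewrite mulr0; exact: span_prod0.
- by rewrite mulrDr; exact: span_prodD.
by rewrite mulrACA; apply: span_prod_gen; [exact: AM|exact: BM].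
Qed.

Lemma TA e a u : A a -> T e u -> T e (a * u).
Proof. by move=> Aa; apply: span_prodMl => b; exact: AM. Qed.

Lemma T_gen e b : B e b -> T e b.
Proof. by move=> Bb; rewrite -[b]mul1r; exact: span_prod_gen. Qed.

(** Since 1 = pi / pi is a quotient of degree one, [T e] behaves as the polynomials of degree at
    most [e], not exactly [e]. *)
Lemma TS e u : T e u -> T e.+1 u.
Proof. by move=> Tu; rewrite -[u]mulr1 -addn1; apply: TM => //; exact: T_gen. Qed.

Lemma approximableD k u v :
  approximable k u -> approximable k v -> approximable k (u + v).
Proof.
move=> [w Tw Ru] [w' Tw' Rv]; exists (w + w').
  by case: k Tw Tw' {Ru Rv} => [-> ->|k]; [rewrite addr0 | exact: span_prodD].
by rewrite opprD addrACA; exact: RD.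
Qed.

Lemma approximableA k a v : A a -> approximable k v -> approximable k (a * v).
Proof.
move=> Aa [w Tw Rv]; exists (a * w).
  by case: k Tw {Rv} => [->|k]; [rewrite mulr0 | exact: TA].
by rewrite -mulrBr; apply: RS => //; exact: AS.
Qed.

Lemma approximableB k u v :
  approximable k u -> approximable k v -> approximable k (u - v).
Proof.
by move=> Au Av; rewrite -mulN1r; apply: approximableD => //; exact: approximableA.
Qed.

Lemma approximableR k v : R k v -> approximable k v.
Proof.
move=> Rv; exists 0; last by rewrite subr0.
by case: k {Rv} => // k; exact: span_prod0.
Qed.

Lemma approximable0 k : approximable k 0.
Proof. exact: approximableR. Qed.

(** The factor [b - t] has degree at most one and lies in [I]: it raises the degree bound and the
    power of the ideal together. *)
Lemma approximable_delta k b t v : B 1 b -> A t -> I (b - t) ->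
  approximable k v -> approximable k.+1 ((b - t) * v).
Proof.
move=> Bb At Ibt [w Tw Rv]; exists ((b - t) * w); last by rewrite -mulrBr; exact: RI.
case: k Tw {Rv} => [->|k Tw]; first by rewrite mulr0; exact: span_prod0.
rewrite mulrBl; apply: span_prodD; first by rewrite -add1n; apply/TM/Tw/T_gen.
by rewrite -mulN1r; apply: TA => //; apply/TS/TA.
Qed.

(* Write the degree one factor b as t + (b - t), with t in A and b - t in I. *)
Lemma approximable_form e b k : B e b -> approximable k b.
Proof.
elim: e b k => [|e IHe] b k Bb.
  case: k => [|k]; first by apply/approximableR/S_R0/AS/B00.
  exists b; last by rewrite subrr.
  suff: T 0 b by elim: k => // k IHk /IHk; exact: TS.
  by rewrite -[b]mulr1; apply: span_prod_gen => //; exact: B00.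
elim/span_prod_ind: (BS Bb) => [|? ?|c b' Bc Bb'].
- exact: approximable0.
- exact: approximableD.
have [t At Ict] := Bdelta Bc; rewrite -[c](subrK t) mulrDl.
apply: approximableD; last by apply: approximableA => //; exact: IHe.
(* The factor [c - t] gains one power, so [b'] is needed only to order [k]. At order 0 membership in
   [R 0] suffices. *)
case: k => [|k]; last by apply: approximable_delta => //; exact: IHe.
have [w w0 Rv] := IHe _ 0%N Bb'; rewrite w0 subr0 in Rv.
by apply/approximableR/RS => //; exact: IS.
Qed.

Lemma approximableT e k w : T e w -> approximable k w.
Proof.
elim/span_prod_ind => [|? ?|a b Aa Bb]; first exact: approximable0.
  exact: approximableD.
by apply: approximableA => //; exact: approximable_form Bb.
Qed.

(* With e = G - g in I, the equation v = F / G reads v = (F - e v) / g. *)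
Lemma approximable_quotient b F G g g' v k :
    S v -> T b F -> T b G -> A g -> A g' -> g' * g = 1 -> I (G - g) ->
  G * v = F -> approximable k v.
Proof.
move=> Sv TF TG Ag Ag' g'g IGg GvF.
have vE : v = g' * F - g' * ((G - g) * v).
  by rewrite -GvF -mulrBr mulrBl opprB addrCA subrr addr0 mulrA g'g mul1r.
(* Iterating the equation [vE] produces the geometric series: an approximation [w] of order [k] is
   substituted for [v] on the right. *)
elim: k => [|k [w Tw Rw]]; first exact/approximableR/S_R0.
rewrite vE; apply: approximableB; apply: approximableA => //.
  exact: approximableT TF.
(* The error [v - w] gains one power of the ideal from [G - g]. *)
rewrite -[v](subrK w) mulrDr; apply: approximableD; first exact/approximableR/RI.
rewrite mulrBl; case: k Tw {Rw} => [->|k Tw].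
  by rewrite !mulr0 subr0; exact: approximable0.
(* The products [G * w] and [g * w] may have too large a degree; [approximableT] brings it down
   again modulo the ideal power. *)
exact: approximableB (approximableT _ (TM TG Tw)) (approximableT _ (TA Ag Tw)).
Qed.

End Approximation.

(** * Arithmetic of fractions *)

Section TofracDiv.
Variable R : idomainType.
Implicit Types a b c e : R.
Local Notation "f %:F" := (tofrac f).

Lemma tofrac_divM a b c e : a%:F / b%:F * (c%:F / e%:F) = (a * c)%:F / (b * e)%:F.
Proof. by rewrite mulf_div -!tofracM. Qed.

Lemma tofrac_divB a b c e : b != 0 -> e != 0 ->
  a%:F / b%:F - c%:F / e%:F = (e * a - c * b)%:F / (e * b)%:F.
Proof.
move=> b0 e0; rewrite -mulNr addf_div ?tofrac_eq0 // tofracB !tofracM mulNr.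
by rewrite [e%:F * a%:F]mulrC [e%:F * b%:F]mulrC.
Qed.

Lemma tofrac_div_inv a b : a != 0 -> b != 0 -> a%:F / b%:F * (b%:F / a%:F) = 1.
Proof.
by move=> a0 b0; rewrite tofrac_divM [b * a]mulrC divff // tofrac_eq0 mulf_neq0.
Qed.

Lemma tofrac_div_trans a b c : a != 0 -> a%:F / b%:F * (c%:F / a%:F) = c%:F / b%:F.
Proof. by move=> a0; rewrite mulrC mulrA divfK // tofrac_eq0. Qed.

Lemma tofrac_div_sum (I : finType) (F : I -> R) b :
  (\sum_i F i)%:F / b%:F = \sum_i ((F i)%:F / b%:F).
Proof. by rewrite rmorph_sum mulr_suml. Qed.

Lemma tofrac_divD a b c : (a + b)%:F / c%:F = a%:F / c%:F + b%:F / c%:F.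
Proof. by rewrite tofracD mulrDl. Qed.

Lemma tofrac_div1 a : a%:F / 1%:F = a%:F.
Proof. by rewrite tofrac1 divr1. Qed.

Lemma tofrac_div_mul a b c : b != 0 -> a%:F / b%:F * (c * b)%:F = (a * c)%:F.
Proof.
move=> b0; rewrite -[(c * b)%:F]tofrac_div1 tofrac_divM mulr1 mulrA tofracM.
by rewrite mulfK ?tofrac_eq0.
Qed.

Lemma tofrac_div_mulK a b c : c != 0 -> a%:F / (b * c)%:F * c%:F = a%:F / b%:F.
Proof.
move=> c0; rewrite -[c%:F]tofrac_div1 tofrac_divM mulr1 -tofrac_divM.
by rewrite divff ?mulr1 // tofrac_eq0.
Qed.

End TofracDiv.

(** * Approximation over a basic open set of X *)

Section LocalApproximation.
Variables (K : fieldType) (V : vectType K) (m : nat).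

Local Notation N := (m * dim V)%N.
Local Notation RX := {mpoly K[N]}.
Local Notation RY := {mpoly K[N + N]}.
Local Notation LX := {fraction RX}.
Local Notation LY := {fraction RY}.
Local Notation Xpoint := (Xpoint V m).
Local Notation Ypoint := (Ypoint V m).
Local Notation pX := (@pull_p K V m).
Local Notation qX := (@pull_q K V m).
Local Notation restr := (@restr_diagonal K V m).
Local Notation "f %:F" := (tofrac f).

Let pI : injective pX := can_inj (@restr_pull_p K V m).
Let qI : injective qX := can_inj (@restr_pull_q K V m).

Let pX0 f : f != 0 -> pX f != 0.
Proof. by move=> f0; rewrite -(rmorph0 pX) (inj_eq pI). Qed.
Let qX0 f : f != 0 -> qX f != 0.
Proof. by move=> f0; rewrite -(rmorph0 qX) (inj_eq qI). Qed.

(** The neighbourhood W is the locus where [h] does not vanish, and [pi] trivializes O(1) on it. The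
    point [x0] of W ensures that [pi] is a nonzero polynomial. *)
Variables (d : nat) (pi h : RX) (x0 : Xpoint).
Hypotheses (pi1 : formX 1 pi) (hx0 : evalX x0 h != 0).
Hypothesis pi_unit : forall y : Xpoint, evalX y h != 0 -> evalX y pi != 0.

Local Notation over P := (on_diagonal P /\ evalX (pr_p P) h != 0).

Lemma evalX_pr_q (P : Ypoint) f : on_diagonal P -> evalX (pr_q P) f = evalX (pr_p P) f.
Proof.
by move=> diagP; rewrite -{2}(restr_pull_q f) evalX_restr // evalY_pull_q.
Qed.

(** One fraction has to serve on all of W; this is at least as strong as regularity in each
    stalk. *)
Definition regular_on (a : LY) : Prop := exists k f g,
  [/\ formX k f, formX k g, forall y : Xpoint, evalX y h != 0 -> evalX y g != 0
    & a = (pX f)%:F / (pX g)%:F].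

Definition form_quotient e (b : LY) : Prop :=
  exists2 f, formX e f & b = (qX f)%:F / (qX (pi ^+ e))%:F.

Definition stalk_over (v : LY) : Prop :=
  forall P : Ypoint, over P -> stalkY P v.
Definition ideal_over (v : LY) : Prop :=
  forall P : Ypoint, over P -> ideal_diagonal P v.

(** Here [v] is the coordinate of a section of the pullback of O(d) in the trivialization by the
    [d]-th power of [pi], whence the factor. *)
Definition power_over k (v : LY) : Prop := forall P : Ypoint, over P ->
  ideal_power_pullback_q d P k (v * (qX (pi ^+ d))%:F).

Let pi_exp k : formX k (pi ^+ k).
Proof. by rewrite -{1}[k]mul1n; exact: formX_exp. Qed.

Let pi_exp_unit (y : Xpoint) k : evalX y h != 0 -> evalX y (pi ^+ k) != 0.
Proof. by move=> hy; rewrite rmorphXn expf_neq0 // pi_unit. Qed.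

Let pi_exp0 k : pi ^+ k != 0.
Proof. exact: evalX_neq0 (pi_exp_unit k hx0). Qed.

Lemma regular_onM a b : regular_on a -> regular_on b -> regular_on (a * b).
Proof.
move=> [k [f [g [ff fg g0 ->]]]] [k' [f' [g' [ff' fg' g0' ->]]]].
exists (k + k')%N, (f * f'), (g * g'); split; try exact: formXM.
  by move=> y hy; rewrite rmorphM; apply: mulf_neq0; [exact: g0|exact: g0'].
by rewrite (rmorphM pX f f') (rmorphM pX g g') tofrac_divM.
Qed.

Lemma regular_on_const c : regular_on ((pX c%:MP)%:F).
Proof.
exists 0%N, c%:MP, 1; split; [exact: formXC|exact: formX1| |].
  by move=> y _; rewrite rmorph1 oner_eq0.
by rewrite rmorph1 tofrac_div1.
Qed.

Lemma regular_on1 : regular_on 1.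
Proof. by have := regular_on_const 1; rewrite mpolyC1 !rmorph1. Qed.

Lemma regular_onN1 : regular_on (-1).
Proof.
by have := regular_on_const (-1); rewrite mpolyCN mpolyC1 rmorphN rmorphN !rmorph1.
Qed.

Lemma regular_on_form_div e f :
  formX e f -> regular_on ((pX f)%:F / (pX (pi ^+ e))%:F).
Proof.
by move=> ff; exists e, f, (pi ^+ e); split=> // y; exact: pi_exp_unit.
Qed.

Lemma regular_on_stalk a : regular_on a -> stalk_over a.
Proof.
move=> [k [f [g [ff fg g0 ->]]]] P [_ hP].
exists k, 0%N, (pX f), (pX g); split; try exact: formY_pull_p.
  by rewrite evalY_pull_p g0.
by [].
Qed.

Lemma form_quotientM e e' b b' :
  form_quotient e b -> form_quotient e' b' -> form_quotient (e + e') (b * b').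
Proof.
move=> [f ff ->] [f' ff' ->]; exists (f * f'); first exact: formXM.
by rewrite exprD (rmorphM qX f f') (rmorphM qX (pi ^+ e) _) tofrac_divM.
Qed.

Lemma form_quotient_exp e : form_quotient e 1.
Proof.
exists (pi ^+ e) => //; have := qX0 (pi_exp0 e); move: (qX _) => f f0.
by rewrite divff // tofrac_eq0.
Qed.

(** Forms of degree 0 are constants, on which the two pullbacks agree. *)
Lemma form_quotient0_regular b : form_quotient 0 b -> regular_on b.
Proof.
move=> [f /formX_degree0[c ->] ->]; rewrite expr0 rmorph1 tofrac_div1.
by rewrite pull_qC -pull_pC; exact: regular_on_const.
Qed.

Lemma form_quotientS e b :
  form_quotient e.+1 b -> span_prod (form_quotient 1) (form_quotient e) b.
Proof.
move=> [f ff ->]; move: f ff; apply: formX_degreeS => [|f g Af Ag|i f ff].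
- by rewrite rmorph0 tofrac0 mul0r; exact: span_prod0.
- by rewrite (rmorphD qX f g) tofrac_divD; exact: span_prodD.
rewrite exprS (rmorphM qX _ f) (rmorphM qX pi _) -tofrac_divM.
apply: span_prod_gen; last by exists f.
by exists (plucker_form i); [exact: formX_pl|rewrite expr1].
Qed.

(** On the diagonal both denominators become [pi ^+ (a + b)] and both numerators [restr G], so the
    numerator of the difference restricts to 0. *)
Lemma ideal_over_sub_restr a b G : formY a b G ->
  ideal_over (G%:F / (pX (pi ^+ a) * qX (pi ^+ b))%:F
              - (pX (restr G))%:F / (pX (pi ^+ (a + b)))%:F).
Proof.
move=> fG P [diagP hP].
have rG := formX_restr fG.
set D := pX (pi ^+ a) * _; set E := pX (pi ^+ (a + b)).
have D0 : D != 0 by exact: (@mulf_neq0 RY _ _ (pX0 (pi_exp0 a)) (qX0 (pi_exp0 b))).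
have fD : formY a b D by exact: formY_gen.
have fE : formY (a + b) 0 E by exact: formY_pull_p.
exists (a + b + a)%N, (0 + b)%N, (E * G - pX (restr G) * D), (E * D); split.
- apply: formYD; first exact: formYM.
  rewrite -mulNr -(rmorphN pX); apply: formYM => //; apply: formY_pull_p.
  by rewrite -mulN1r -mpolyC1 -mpolyCN; apply: (@formXM _ _ _ 0) => //; exact: formXC.
- exact: formYM.
- rewrite evalYM /E /D evalYM !evalY_pull_p evalY_pull_q evalX_pr_q //.
  by rewrite !mulf_neq0 ?pi_exp_unit.
- move=> _; rewrite restrB !restrM !restr_pull_p restr_pull_q.
  by rewrite exprD mulrC subrr.
exact: (@tofrac_divB RY G D (pX (restr G)) E D0 (pX0 (pi_exp0 _))).
Qed.

Lemma form_quotient_delta b : form_quotient 1 b ->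
  exists2 t, regular_on t & ideal_over (b - t).
Proof.
move=> [f ff ->]; exists ((pX f)%:F / (pX (pi ^+ 1))%:F).
  exact: regular_on_form_div.
have := ideal_over_sub_restr (formY_pull_q ff).
by rewrite restr_pull_q add0n [pi ^+ 0]expr0 (rmorph1 pX) mul1r.
Qed.

Lemma span_form_quotient a b F : formY a b F ->
  span_prod regular_on (form_quotient b) (F%:F / (pX (pi ^+ a) * qX (pi ^+ b))%:F).
Proof.
move=> [r [g [f [fg ff ->]]]]; rewrite tofrac_div_sum.
apply: (big_ind (span_prod regular_on (form_quotient b))) => [|u v|i _].
- exact: span_prod0.
- exact: span_prodD.
rewrite -tofrac_divM; apply: span_prod_gen; first exact: regular_on_form_div.
by exists (f i).
Qed.

Let map_frac_form f : map_frac qX f%:F = (qX f)%:F.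
Proof.
by rewrite -{1}[f%:F]tofrac_div1 map_frac_div ?oner_neq0 // rmorph1 tofrac_div1.
Qed.

(** The form [pi ^+ d] is itself a global section of O(d). *)
Lemma power_over0 v : stalk_over v -> power_over 0 v.
Proof.
move=> Sv P oP; apply: span_prod_gen; first exact: Sv.
exists (pi ^+ d)%:F; last by rewrite map_frac_form.
exact: (sectionX_form (pi_exp d)).
Qed.

(** Dividing [F] and [G] by the monomial of bidegree [(a, b)] in the two pullbacks of [pi] makes
    them polynomials in the ratios to [pi]. The restriction of [G] to the diagonal, divided by
    [pi ^+ (a + b)], is a unit on W congruent to the new denominator. *)
Lemma approximable_fraction a b (F G : RY) k :
    formY a b F -> formY a b G ->
    (forall y : Xpoint, evalX y h != 0 -> evalX y (restr G) != 0) ->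
  approximable regular_on form_quotient power_over k (F%:F / G%:F).
Proof.
move=> fF fG G_unit.
have rG0 : restr G != 0 by exact: evalX_neq0 (G_unit _ hx0).
have G0 : G != 0 by apply: contraNneq rG0 => ->; rewrite rmorph0.
apply: (@approximable_quotient LY regular_on stalk_over ideal_over form_quotient
  power_over regular_on1 regular_onN1 regular_onM form_quotient0_regular
  (form_quotient_exp 0) (form_quotient_exp 1) form_quotientM form_quotientS
  form_quotient_delta regular_on_stalk _ _ power_over0 _ _ _ b
  (F%:F / (pX (pi ^+ a) * qX (pi ^+ b))%:F)
  (G%:F / (pX (pi ^+ a) * qX (pi ^+ b))%:F)
  ((pX (restr G))%:F / (pX (pi ^+ (a + b)))%:F)
  ((pX (pi ^+ (a + b)))%:F / (pX (restr G))%:F)).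
- by move=> u Iu P /Iu; exact: ideal_diagonal_stalkY.
- by move=> j P _; rewrite mul0r; exact: ideal_power0.
- by move=> j u v Ru Rv P oP; rewrite mulrDl;
    apply: ideal_powerD; [exact: Ru|exact: Rv].
- by move=> j u v Su Rv P oP; rewrite -mulrA;
    apply: ideal_powerMl; [exact: Su|exact: Rv].
- by move=> j u v Iu Rv P oP; rewrite -mulrA;
    apply: span_prod_gen; [exact: Iu|exact: Rv].
- by move=> P [diagP hP]; exists a, b, F, G; split=> //; rewrite -evalX_restr ?G_unit.
- exact: span_form_quotient.
- exact: span_form_quotient.
- by apply: regular_on_form_div; exact: formX_restr.
- by exists (a + b)%N, (pi ^+ (a + b)), (restr G); split=> //; exact: formX_restr.
- exact: (@tofrac_div_inv RY _ _ (pX0 (pi_exp0 _)) (pX0 rG0)).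
- exact: ideal_over_sub_restr.
- exact: (@tofrac_div_trans RY G _ F G0).
Qed.

(** An approximation to order [l.+1] has degree at most [l]; its coefficients become the [phi i] and
    its forms, raised to degree [d], the [sigma i]. *)
Lemma approximable_taylor l v : (l <= d)%N ->
    approximable regular_on form_quotient power_over l.+1 v ->
  exists r (sigma phi : 'I_r -> LX),
    [/\ forall i, sectionX d (fun=> True) (sigma i),
        forall i, sectionX 0 (fun y : Xpoint => evalX y h != 0) (phi i)
      & forall P : Ypoint, over P ->
          ideal_pullback_q d l P (taylor sigma phi P - v * (qX (pi ^+ d))%:F)].
Proof.
move=> led [w [r [a [b [ra qb wE]]]] Rv].
have /fin_all_exists[phi /all_and2[phi_reg phiE]] i : exists u : LX,
    sectionX 0 (fun y : Xpoint => evalX y h != 0) u /\ map_frac pX u = a i.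
  have [k [f [g [ff fg g0 ->]]]] := ra i.
  exists (f%:F / g%:F); split; last by rewrite map_frac_div // (evalX_neq0 (g0 _ hx0)).
  by move=> y hy; exists k, f, g; rewrite addn0; split=> //; exact: g0.
have /fin_all_exists[sigma /all_and2[sigma_reg sigmaE]] i : exists u : LX,
    sectionX d (fun=> True) u /\ map_frac qX u = b i * (qX (pi ^+ d))%:F.
  have [f ff ->] := qb i.
  (* The inequality [l <= d] enters here: multiplying by the [d]-th power of [pi] cancels the
     denominator [pi ^+ l] and leaves a form of degree [d]. *)
  exists (f * pi ^+ (d - l))%:F; split.
    by apply: sectionX_form; rewrite -(subnKC led) addKn; exact: formXM.
  rewrite map_frac_form (rmorphM qX f _) -{2}(subnK led) exprD (rmorphM qX _ (pi ^+ l)).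
  by rewrite tofrac_div_mul // qX0.
exists r, sigma, phi; split=> // P oP.
have -> : taylor sigma phi P = w * (qX (pi ^+ d))%:F.
  rewrite /taylor wE mulr_suml; apply: eq_bigr => i _.
  by rewrite phiE sigmaE mulrA.
have := ideal_powerB (ideal_power0 d P l.+1) (Rv P oP).
by rewrite sub0r -mulNr opprB mulrBl.
Qed.

End LocalApproximation.

(** * Nonvanishing maximal minors *)

Section NonvanishingMinor.
Variables (F : fieldType) (m n : nat).

Lemma row_free_vbasis (W : {vspace 'rV[F]_n}) : \dim W = m ->
  row_free (\matrix_(i < m) (vbasis W)`_i).
Proof.
move=> dimW; subst m; apply: inj_row_free => u uW0.
have /freeP freeW := basis_free (vbasisP W).
apply/rowP => i; rewrite mxE; apply: (freeW (u 0)).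
rewrite -[RHS]uW0 mulmx_sum_row; apply: eq_bigr => j _.
by rewrite rowK.
Qed.

(** The transpose has rank [m], so [m] of its rows form an invertible matrix. *)
Lemma row_free_minor (A : 'M[F]_(m, n)) : row_free A ->
  exists2 f : 'I_m -> 'I_n, injective f & \det (colsub f A) != 0.
Proof.
rewrite /row_free -mxrank_tr => rkA.
exists (fullrankfun rkA); first exact: fullrankfun_inj.
have := fullrowsub_full rkA; rewrite row_full_unit unitmxE unitfE.
by rewrite -det_tr /= trmx_mxsub trmxK.
Qed.

(* Up to the order of its columns, a square submatrix is determined by the set
   of its columns. *)
Lemma minor_image (A : 'M[F]_(m, n)) (f g : 'I_m -> 'I_n) :
  (forall i, exists j, f i = g j) -> \det (colsub f A) != 0 ->
  \det (colsub g A) != 0.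
Proof.
move=> /fin_all_exists[t ft].
have -> : colsub f A = colsub g A *m colsub t 1%:M.
  by rewrite mulmx_colsub mulmx1; apply/matrixP => i j; rewrite !mxE ft.
by rewrite det_mulmx mulf_eq0 negb_or => /andP[].
Qed.

End NonvanishingMinor.

(** * Local surjectivity along the diagonal *)

Section LocalTaylor.
Variables (K : fieldType) (V : vectType K) (m : nat).

Local Notation N := (m * dim V)%N.
Local Notation RX := {mpoly K[N]}.
Local Notation RY := {mpoly K[N + N]}.
Local Notation LX := {fraction RX}.
Local Notation LY := {fraction RY}.
Local Notation Xpoint := (Xpoint V m).
Local Notation Ypoint := (Ypoint V m).
Local Notation pX := (@pull_p K V m).
Local Notation qX := (@pull_q K V m).
Local Notation restr := (@restr_diagonal K V m).
Local Notation "f %:F" := (tofrac f).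

Lemma evalX_plucker (x : Xpoint) (J : plidx V m) :
  evalX x (plucker (generic_frame V m) J) = plucker (frame (Xplane x)) J.
Proof.
rewrite /plucker -det_map_mx; congr (\det _); apply/matrixP => i j.
by rewrite !mxE /= evalX_X mxvecE mxE.
Qed.

(** A frame has rank [m], hence a nonzero minor; listing its columns in the order of [enum_val]
    keeps it nonzero. *)
Lemma plucker_form_neq0 (x : Xpoint) : exists i, evalX x (@plucker_form K V m i) != 0.
Proof.
have [f f_inj f0] := row_free_minor (row_free_vbasis (plane_dim (Xplane x))).
have cardJ : #|f @: setT| == m by rewrite card_imset // cardsT card_ord.
pose J : plidx V m := Sub (f @: setT) cardJ.
exists (enum_rank J); rewrite /plucker_form enum_rankK evalX_plucker.
apply: minor_image f0 => i.
have fiJ : f i \in f @: setT by rewrite imset_f.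
(* This is the position of the column [f i] in the enumeration of [J]. *)
exists (cast_ord (eqP (valP J)) (enum_rank_in fiJ (f i))).
by rewrite cast_ordK enum_rankK_in.
Qed.

Variables (d l : nat).
Hypothesis led : (l <= d)%N.

(** Agreement is required at diagonal points only; elsewhere the jet quotient is zero. *)
Definition locally_taylor (x : Xpoint) (u : LY) : Prop := exists k (h : RX),
  [/\ formX k h, evalX x h != 0 & exists r (sigma phi : 'I_r -> LX),
    [/\ forall i, sectionX d (fun=> True) (sigma i),
        forall i, sectionX 0 (fun y : Xpoint => evalX y h != 0) (phi i)
      & forall P : Ypoint, on_diagonal P -> evalX (pr_p P) h != 0 ->
          ideal_pullback_q d l P (taylor sigma phi P - u)]].

Lemma locally_taylor0 x : locally_taylor x 0.
Proof.
exists 0%N, 1; split; [exact: formX1|by rewrite rmorph1 oner_eq0|].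
exists 0%N, (fun=> 0), (fun=> 0); split=> [[]|[]|P _ _] //.
by rewrite /taylor big_ord0 subr0; exact: (ideal_power0 d P l.+1).
Qed.

(** The two basic open sets are intersected and the two families concatenated. *)
Lemma locally_taylorD x u v :
  locally_taylor x u -> locally_taylor x v -> locally_taylor x (u + v).
Proof.
move=> [k [h [fh h0 [r [sigma [phi [ssec psec tE]]]]]]].
move=> [k' [h' [fh' h0' [r' [sigma' [phi' [ssec' psec' tE']]]]]]].
have hh y : evalX y (h * h') != 0 -> evalX y h != 0 /\ evalX y h' != 0.
  by rewrite evalXM mulf_eq0 negb_or => /andP[].
exists (k + k')%N, (h * h'); split; first exact: formXM.
  by rewrite evalXM; apply: mulf_neq0.
exists (r + r')%N.
exists (fun i => match split i with inl j => sigma j | inr j => sigma' j end).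
exists (fun i => match split i with inl j => phi j | inr j => phi' j end).
split=> [i|i|P diagP /hh[hP h'P]].
- by case: split.
- by case: split => j y /hh[hy h'y]; [exact: psec | exact: psec'].
have := ideal_powerD (k := l.+1) (tE P diagP hP) (tE' P diagP h'P).
rewrite addrACA -opprD; congr (ideal_pullback_q d l P (_ - _)).
rewrite /taylor big_split_ord; congr (_ + _); apply: eq_bigr => i _.
  by rewrite (unsplitK (inl i)).
by rewrite (unsplitK (inr i)).
Qed.

Definition diagonal_point (x : Xpoint) : Ypoint :=
  YPoint (Xstruct x) (Xplane x) (Xplane x).

Lemma pr_p_diagonal x : pr_p (diagonal_point x) = x.
Proof. by case: x. Qed.

Lemma pr_q_diagonal x : pr_q (diagonal_point x) = x.
Proof. by case: x. Qed.

Lemma evalX_restr_diagonal x f : evalX x (restr f) = evalY (diagonal_point x) f.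
Proof. by rewrite -evalX_restr ?pr_p_diagonal //; case: x. Qed.

Lemma locally_taylor_gen x a u :
    stalkY (diagonal_point x) a -> stalkX d x u ->
  locally_taylor x (a * map_frac qX u).
Proof.
move=> [i [j [f [g [ff fg g0 ->]]]]] [k [f' [g' [ff' fg' g0' ->]]]].
have [s pi0] := plucker_form_neq0 x; set pi := plucker_form s in pi0.
have pi1 : formX 1 pi by exact: formX_pl.
have pid : formX d (pi ^+ d) by rewrite -{1}[d]mul1n; exact: formX_exp.
(* Dividing the generator by the pullback of [pi ^+ d] gives a fraction with denominator [G]; the
   factor [pi ^+ d] balances the degree excess of [f'] over [g']. *)
pose G := g * qX (g' * pi ^+ d).
have fG : formY (i + 0) (j + (k + d)) G.
  by apply: formYM => //; apply: formY_pull_q; exact: formXM.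
have fF : formY (i + 0) (j + (k + d)) (f * qX f').
  by apply: formYM => //; exact: formY_pull_q.
have G0 : evalX x (restr G) != 0.
  rewrite /G restrM restr_pull_q !evalXM (rmorphXn (evalX x)).
  by rewrite !mulf_neq0 ?expf_neq0 // evalX_restr_diagonal.
(* The neighbourhood is cut out by [pi * restr G], so that both factors are units on it. *)
have h0 : evalX x (pi * restr G) != 0 by rewrite evalXM mulf_neq0.
have hh y : evalX y (pi * restr G) != 0 -> evalX y pi != 0 /\ evalX y (restr G) != 0.
  by rewrite evalXM mulf_eq0 negb_or => /andP[].
have pi_unit y : evalX y (pi * restr G) != 0 -> evalX y pi != 0 by move/hh => [].
have G_unit y : evalX y (pi * restr G) != 0 -> evalX y (restr G) != 0 by move/hh => [].
have v_app :=
  @approximable_fraction K V m d pi _ x pi1 h0 pi_unit _ _ _ _ l.+1 fF fG G_unit.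
have [r [sigma [phi [ssec psec tE]]]] := approximable_taylor pi1 h0 pi_unit led v_app.
exists (1 + (i + 0 + (j + (k + d))))%N, (pi * restr G); split => //.
  by apply: formXM => //; exact: formX_restr.
exists r, sigma, phi; split=> // P diagP hP.
have := tE P (conj diagP hP); congr (ideal_pullback_q d l P (_ - _)).
have g'0 := evalX_neq0 g0'.
rewrite map_frac_div //; last exact: (can_inj (@restr_pull_q K V m)).
have q0 : qX (pi ^+ d) != 0.
  apply: contraTneq isT => q0; have := congr1 restr q0; rewrite restr_pull_q rmorph0.
  by move/eqP; rewrite expf_eq0 (negbTE (evalX_neq0 pi0)) andbF.
rewrite /G (rmorphM qX g') mulrA tofrac_divM.
exact: (@tofrac_div_mulK _ (f * qX f') (g * qX g') (qX (pi ^+ d)) q0).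
Qed.

Lemma locally_taylor_pullback x u :
  pullback_q d (diagonal_point x) u -> locally_taylor x u.
Proof.
elim/span_prod_ind => [|v w|a b Sa [v Sv ->]].
- exact: locally_taylor0.
- exact: locally_taylorD.
by apply: locally_taylor_gen => //; rewrite pr_q_diagonal in Sv.
Qed.

End LocalTaylor.

(** * Surjectivity of the Taylor morphism *)

Theorem corollary3p11 (K : fieldType) (V : vectType K) (m n d l : nat)
    (dimV : \dim {:V} = (m + n)%N) (l_ge1 : (1 <= l)%N) (l_led : (l <= d)%N) :
  taylor_surjective V m d l.
Proof.
move=> U s openU secs x Ux.
(* The section is first expanded at the diagonal point over [x]. *)
have Up : U (pr_p (diagonal_point x)) by rewrite pr_p_diagonal.
have [O [u [openO Ox OU Os]]] := secs _ Up.
have [i [f [ff fx fU]]] := openU x Ux.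
have [a [b [g [fg gx gO]]]] := openO _ Ox.
have [k [h [fh hx [r [sigma [phi [ssec psec tE]]]]]]] :=
  locally_taylor_pullback l_led (Os _ Ox).1.
(* Of the three factors, [h] gives the Taylor expansion of [u], [f] keeps W inside [U], and the
   restriction of [g] keeps the diagonal points over W inside [O]. *)
pose W (y : Xpoint V m) := evalX y (h * (f * restr_diagonal g)) != 0.
have Wh y : W y ->
    [/\ evalX y h != 0, evalX y f != 0 & evalX y (restr_diagonal g) != 0].
  by rewrite /W !evalXM !mulf_eq0 !negb_or => /and3P.
have WU y : W y -> U y by move/Wh => [_ + _]; exact: fU.
exists W; split=> //.
- move=> y Wy; exists (k + (i + (a + b)))%N, (h * (f * restr_diagonal g)); split=> //.
  by apply/formXM/formXM => //; exact: formX_restr.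
- by rewrite /W !evalXM !mulf_neq0 // evalX_restr_diagonal.
have psecW j : sectionX 0 W (phi j) by move=> y /Wh[hy _ _]; exact: psec.
exists r, sigma, phi; split=> // P WP.
have [hP _ gP] := Wh _ WP.
case: (eqVneq (plane_space (Yplane1 P)) (plane_space (Yplane2 P))) => [diagP|offP].
  have OP : O P by apply: gO; rewrite -evalX_restr.
  (* Both the Taylor image and [s P] are congruent to [u]. *)
  have := ideal_powerB (k := l.+1) (tE P diagP hP) (Os P OP).2.
  by rewrite opprB addrA subrK.
(* Off the diagonal it remains to see that [s P] lies in the pullback; this comes from the local
   representative [u'] at [P] itself, since [P] may lie outside [O]. *)
have [O' [u' [_ O'P _ Os']]] := secs P (WU _ WP).
have [pu' su'] := Os' P O'P.
have sP : pullback_q d P (s P).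
  rewrite -[s P](subrK u').
  exact: (@ideal_powerD _ _ _ d P 0 _ _ (ideal_power_pullback (k := l.+1) su') pu').
apply: (@ideal_power_off_diagonal _ _ _ d P l.+1); first exact/eqP.
apply: (@ideal_powerB _ _ _ d P 0) => //.
exact: taylor_pullback_q ssec psecW WP.
Qed.
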